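(* Fix a connected weighted graph on $n$ vertices with Laplacian $L$, a pair $(p,q)$ of distinct vertices, and $w\ge 0$. Let $\gamma:=\lambda_2-\lambda_1$, $\beta_k:=\beta_k(p,q)$, $T_{3+}:=T_{3+}(p,q)$. Assume that $\lambda_1<\lambda_2$ and that, for some constants $\rho_0\in(0,1)$, $a_0>0$, $A_0>0$, $L_0>0$, $w_0>0$, $\theta_0\in(0,1)$, one has $$\lambda_2\le\rho_0\lambda_3,\qquad \beta_1^2\ge\frac{a_0}{n},\qquad T_{3+}\le A_0n,\qquad \lambda_2\le\frac{L_0}{n^2},\qquad w\ge w_0,$$ and $$\gamma\left(\frac1w+\frac{T_{3+}}{1-\rho_0}\right)\le\theta_0\beta_1^2.$$ If, for some $\varepsilon\ge0$, $\beta_2^2\le\varepsilon\beta_1^2$, then $$0\le\gamma-\Delta_{p,q}(w)\le\frac{\gamma}{1-\theta_0}\,\varepsilon.$$ Consequently, $$0\le\gamma-\Delta_{p,q}(w)\le C\frac{w}{n}\varepsilon,$$ where $C$ depends only on $L_0$, $w_0$ and $\theta_0$.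
   Context: The graph has nonnegative symmetric edge weights and Laplacian $L=D-A$ ($A$ weighted adjacency matrix, $D$ diagonal matrix of weighted degrees); $n\ge4$. The eigenvalues of $L$ are $0=\lambda_0<\lambda_1\le\lambda_2\le\cdots\le\lambda_{n-1}$ with a fixed orthonormal eigenbasis $\boldsymbol u_0=\boldsymbol 1/\sqrt n,\boldsymbol u_1,\dots,\boldsymbol u_{n-1}$, and $u_{k,i}$ is the $i$th entry of $\boldsymbol u_k$. For a pair $(p,q)$, $$\beta_k(p,q):=u_{k,p}-u_{k,q}\ (k=1,\dots,n-1),\qquad T_{3+}(p,q):=\sum_{k=3}^{n-1}\frac{\beta_k(p,q)^2}{\lambda_k}.$$ With $\boldsymbol b_{pq}=\boldsymbol e_p-\boldsymbol e_q$, set $L_{p,q}(w):=L+w\boldsymbol b_{pq}\boldsymbol b_{pq}^\top$ and $\Delta_{p,q}(w):=\lambda_1(L_{p,q}(w))-\lambda_1(L)$, where $\lambda_1(\cdot)$ denotes the second smallest eigenvalue (algebraic connectivity). *)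

(* Defs.v *)
From HB Require Import structures.
From mathcomp Require Import all_boot all_order all_algebra.
From mathcomp Require Import polyrcf reals.
Set Implicit Arguments.
Unset Strict Implicit.
Unset Printing Implicit Defensive.
Import Order.TTheory GRing.Theory Num.Theory.
Local Open Scope ring_scope.

Section WeightedGraphs.
Variables (R : realType) (n : nat).
Implicit Types (A M : 'M[R]_n) (u : nat -> 'cV[R]_n) (p q : 'I_n).

(* A weighted graph on 'I_n is given by its weighted adjacency matrix. The
   diagonal is not required to vanish: a loop cancels in the Laplacian and
   does not affect connectedness. *)
Definition weighted_graph A : Prop :=
  (forall i j, 0 <= A i j) /\ (forall i j, A i j = A j i).

Definition connected_graph A : Prop :=
  forall i j, connect (fun x y => 0 < A x y) i j.

Definition degree_mx A : 'M[R]_n := diag_mx (\row_i \sum_j A i j).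

Definition laplacian A : 'M[R]_n := degree_mx A - A.

(* The eigenvalues of M lying in R, in nondecreasing order and repeated
   according to their multiplicity (for a symmetric M there are n of them). *)
Definition eigenvalues M : seq R :=
  flatten [seq nseq (mup x (char_poly M)) x | x <- rootsR (char_poly M)].

(* Numbered from 0, so that lambda 1 is the second smallest eigenvalue. *)
Definition lambda (k : nat) M : R := (eigenvalues M)`_k.

(* Only the values u k with k < n are meaningful. *)
Definition orthonormal_eigenbasis M u : Prop :=
  (forall k, (k < n)%N -> M *m u k = lambda k M *: u k) /\
  (forall k l, (k < n)%N -> (l < n)%N ->
     \sum_i u k i 0 * u l i 0 = (k == l)%:R).

Definition beta u p q (k : nat) : R := u k p 0 - u k q 0.

Definition T3plus M u p q : R :=
  \sum_(3 <= k < n) beta u p q k ^+ 2 / lambda k M.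

Definition edge_vec p q : 'cV[R]_n := delta_mx p 0 - delta_mx q 0.

Definition edge_update M p q (w : R) : 'M[R]_n :=
  M + w *: (edge_vec p q *m (edge_vec p q)^T).

Definition conn_gain M p q (w : R) : R :=
  lambda 1 (edge_update M p q w) - lambda 1 M.

Lemma eigenvaluesE M (s : seq R) :
  sorted <=%R s -> char_poly M = \prod_(x <- s) ('X - x%:P) ->
  eigenvalues M = s.
Proof.
move=> ss cs; rewrite /eigenvalues.
have p0 : char_poly M != 0 by rewrite monic_neq0 ?char_poly_monic.
have sr : sorted <%R (rootsR (char_poly M)) by apply: sorted_roots.
have mem x : (x \in rootsR (char_poly M)) = root (char_poly M) x.
  by rewrite -(roots_on_rootsR p0).
apply: (sorted_eq le_trans le_anti) => //; last first.
  apply/allP => x _ /=; rewrite -[X in _ == X](mu_prod_XsubC x) -cs.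
  rewrite count_flatten -map_comp.
  rewrite (eq_map (g := fun y => ((y == x) * mup x (char_poly M))%N)); last first.
    move=> y /=; rewrite count_nseq /=.
    by case: eqVneq => [->|].
  rewrite sumnE big_map -big_distrl /=.
  have -> : (\sum_(y <- rootsR (char_poly M)) (y == x) =
             count_mem x (rootsR (char_poly M)))%N.
    by rewrite -sum1_count [RHS]big_mkcond /=; apply: eq_bigr => y _; case: (y == x).
  rewrite count_uniq_mem ?uniq_roots // mem.
  by case: (boolP (root _ _)) => [_|/mupNroot ->]; rewrite ?mul1n ?muln0.
move: sr => {mem}; elim: (rootsR _) => //= a r IHr par.
have sr := path_sorted par.
have /allP ar : all (> a) r by apply: order_path_min par; exact: lt_trans.
rewrite sorted_pairwise; last exact: le_trans.
rewrite pairwise_cat -!(sorted_pairwise le_trans) (IHr sr) andbT.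
apply/andP; split.
  apply/allrelP => x y /nseqP[-> _] /flattenP[_ /mapP[z zr ->]] /nseqP[-> _].
  exact/ltW/ar.
by elim: (mup _ _) => //= [[|m]] //= IHm; rewrite lexx.
Qed.

End WeightedGraphs.

(* Main.v *)
Require Import Defs.
From mathcomp Require Import all_boot all_order all_algebra.
From mathcomp Require Import reals.
From mathcomp Require Import complex.
From mathcomp Require Import ring lra.
Set Implicit Arguments.
Unset Strict Implicit.
Unset Printing Implicit Defensive.
Import Order.TTheory GRing.Theory Num.Theory.
Local Open Scope ring_scope.

(** Write N = L + w b b^T with b = e_p - e_q. As lambda_1(L) cancels,
    gamma - Delta = lambda_2(L) - lambda_1(N), so the claim locates the second
    smallest eigenvalue of N just below lambda_2(L).

    It is at most lambda_2(L) because N is a rank-one perturbation of L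
    ([rank_one_interlacing]): on the hyperplane b^T x = 0 the two quadratic
    forms agree, and giving up that one dimension costs one index.

    For the other side let m = lambda_2 - delta, where
    delta = gamma * eps / (1 - theta0). By the max-min principle ([lambda_ge])
    it is enough that x^T N x >= m |x|^2 whenever x is orthogonal to u_0
    ([perturbed_form_ge]). Put c_k = <u_k, x>. The form x^T L x - m |x|^2 can
    be negative only along u_1, where it loses at most gamma * c_1^2, and that
    loss is repaid by w * <b, x>^2 together with the modes k >= 2. Indeed
      beta_1 c_1 = <b, x> - beta_2 c_2 - sum_(k >= 3) beta_k c_k,
    and the Cauchy-Schwarz inequality with a suitable weight on each summand
    bounds (beta_1 c_1)^2 by F * Q with
      F = 1/w + beta_2^2 / delta + T_(3+) / (1 - rho0),
      Q = w <b, x>^2 + delta c_2^2 + (1 - rho0) sum_(k >= 3) lambda_k c_k^2.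
    The gap hypothesis bounds the first and last terms of F by
    theta0 * beta_1^2 / gamma, and delta is chosen exactly so that the middle
    one is at most (1 - theta0) * beta_1^2 / gamma. Hence
    gamma * F <= beta_1^2 and so gamma * c_1^2 <= Q. Arguing on the quadratic
    form in this way avoids the secular equation of the perturbation, with its
    poles and its case distinctions.

    Both eigenvalue comparisons rest on the spectral theorem for real symmetric
    matrices, which is also what makes the list of real roots of the
    characteristic polynomial complete. It is obtained by deflation
    ([orthonormal_eigenseq_ex]); the existence of one eigenvector in a stable
    subspace ([stable_eigenvector]) comes from the algebraic closure R[i].

    Since gamma <= lambda_2 <= L0 / n^2 and w >= w0, the constant
    L0 / (w0 (1 - theta0)) works in the last bound. *)

(** * Dot products and linear constraints *)

Section DotProduct.
Variables (R : realType) (n : nat).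
Implicit Types (x y z : 'cV[R]_n) (M : 'M[R]_n) (a : R).

Definition dot x y : R := \sum_i x i 0 * y i 0.

Lemma dotE x y : dot x y = (x^T *m y) 0 0.
Proof. by rewrite mxE; apply: eq_bigr => i _; rewrite mxE. Qed.

Lemma dotC x y : dot x y = dot y x.
Proof. by apply: eq_bigr => i _; rewrite mulrC. Qed.

Lemma dotDr x y z : dot x (y + z) = dot x y + dot x z.
Proof. by rewrite !dotE mulmxDr mxE. Qed.

Lemma dotZr a x y : dot x (a *: y) = a * dot x y.
Proof. by rewrite !dotE -scalemxAr mxE. Qed.

Lemma dotZl a x y : dot (a *: x) y = a * dot x y.
Proof. by rewrite dotC dotZr dotC. Qed.

Lemma dot_sym_mx M x y : M^T = M -> dot x (M *m y) = dot (M *m x) y.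
Proof. by move=> Msym; rewrite !dotE trmx_mul Msym mulmxA. Qed.

Lemma dot_gt0 x : x != 0 -> 0 < dot x x.
Proof.
move=> x0; rewrite lt_neqAle eq_sym sumr_ge0 ?andbT; last first.
  by move=> i _; rewrite -expr2 sqr_ge0.
apply: contraNneq x0 => /eqP; rewrite psumr_eq0; last first.
  by move=> i _; rewrite -expr2 sqr_ge0.
move=> /allP x0; apply/eqP/colP => i; rewrite mxE.
by have := x0 i (mem_index_enum i); rewrite mulf_eq0 orbb => /eqP.
Qed.

Lemma kernel_vector r (B : 'M[R]_(r, n)) :
  (r < n)%N -> exists2 x : 'cV[R]_n, x != 0 & B *m x = 0.
Proof.
move=> rn.
have /rowV0Pn[v /sub_kermxP vB v0] : kermx B^T != 0.
  rewrite -mxrank_eq0 mxrank_ker -lt0n subn_gt0.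
  exact: leq_ltn_trans (rank_leq_col _) rn.
exists v^T; first by rewrite trmx_eq0.
by apply: trmx_inj; rewrite trmx_mul trmxK vB trmx0.
Qed.

Lemma kernel_vector_seq (s : seq 'cV[R]_n) :
  (size s < n)%N -> exists2 x : 'cV[R]_n, x != 0 & {in s, forall y, dot y x = 0}.
Proof.
move=> sn; have [x x0 Bx] :=
  kernel_vector (\matrix_(i < size s, j < n) s`_i j 0) sn.
exists x => // y /(nthP 0)[i ilt <-].
have /colP/(_ (Ordinal ilt)) := Bx; rewrite !mxE => <-.
by apply: eq_bigr => j _; rewrite mxE.
Qed.

End DotProduct.

(** * The real spectral theorem *)

Section Spectral.
Variables (R : realType) (n : nat).
Implicit Types (x y : 'cV[R]_n) (M : 'M[R]_n).

(** For an eigenvector z, the number z M z^* is invariant under conjugation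
    and equals a times the nonzero real |z|^2. *)
Lemma sym_eigenvalue_real M (a : R[i]) :
  M^T = M -> eigenvalue (map_mx (real_complex R) M) a -> a \is Num.real.
Proof.
move=> Msym /eigenvalueP[z zM z0].
pose N := \sum_i z 0 i * (z 0 i)^*.
have N0 : N != 0.
  apply: contra z0; rewrite psumr_eq0; last first.
    by move=> i _; rewrite mul_conjC_ge0.
  move=> /allP zi; apply/eqP/rowP => i; rewrite mxE; apply/eqP.
  by have := zi i (mem_index_enum i); rewrite mul_conjC_eq0.
have NJ : N^* = N.
  by rewrite rmorph_sum; apply: eq_bigr => i _; rewrite rmorphM /= conjCK mulrC.
have zMi i : \sum_j z 0 j * real_complex R (M j i) = a * z 0 i.
  have /rowP/(_ i) := zM; rewrite !mxE => <-.
  by apply: eq_bigr => j _; rewrite mxE.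
have aN : a * N = \sum_i \sum_j z 0 j * real_complex R (M j i) * (z 0 i)^*.
  by rewrite mulr_sumr; apply: eq_bigr => i _; rewrite mulrA -zMi mulr_suml.
have conj_toC (r : R) : (real_complex R r)^* = real_complex R r.
  by apply: CrealP; apply/complex_realP; exists r.
apply/CrealP; apply: (mulIf N0); rewrite -[N in LHS]NJ -rmorphM /= aN.
rewrite rmorph_sum /= exchange_big /=; apply: eq_bigr => i _.
rewrite rmorph_sum; apply: eq_bigr => j _ /=.
rewrite !rmorphM /= conjCK conj_toC -[in LHS]Msym mxE.
by rewrite mulrC mulrA mulrAC.
Qed.

(** Over R[i] the restriction of M to V has an eigenvalue; as an eigenvalue of
    the symmetric matrix M it is real, hence already an eigenvalue of the
    restriction over R. *)
Lemma stable_eigenvector M m (V : 'M[R]_(m, n)) :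
  M^T = M -> stablemx V M -> V != 0 ->
  exists2 v : 'rV[R]_n, v != 0 & (v <= V)%MS /\ exists a, v *m M = a *: v.
Proof.
move=> Msym VM V0.
have [B eqBV Bfree] : exists2 B : 'M_(\rank V, n), (B :=: V)%MS & row_free B.
  by exists (row_base V); [exact: eq_row_base | exact: row_base_free].
have BM : stablemx B M by rewrite (eqmx_stable M eqBV).
pose f := conjmx B M.
have r0 : (0 < \rank V)%N by rewrite lt0n mxrank_eq0.
have [a fa] := eigenvalue_closed (map_mx (real_complex R) f) r0.
have /complex_realP[b ab] : a \is Num.real.
  apply: (sym_eigenvalue_real Msym).
  apply: (eigenvalue_conjmx (V := map_mx (real_complex R) B)).
  - by rewrite -map_mxM map_submx.
  - by rewrite row_free_map.
  - by move: fa; rewrite /f /conjmx 2!map_mxM map_pinvmx.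
move: fa; rewrite ab eigenvalue_map => /eigenvalueP[v vf v0].
exists (v *m B).
  by rewrite mulmx_free_eq0.
split; first by rewrite -eqBV submxMl.
exists b; apply/eigenspaceP; rewrite -sub_eigenspace_conjmx //.
exact/eigenspaceP.
Qed.

(** Orthonormality is stated through membership rather than through indices, so
    that it survives the sorting by Rayleigh quotients. *)
Definition orthonormal_eigenseq M (s : seq 'cV[R]_n) : Prop :=
  [/\ uniq s, {in s &, forall x y, dot x y = (x == y)%:R} &
      {in s, forall x, exists a, M *m x = a *: x}].

(** Deflation: the vectors orthogonal to fewer than n given eigenvectors form a
    nonzero subspace, stable because M is symmetric, so it contains a further
    eigenvector. *)
Lemma orthonormal_eigenseq_ex M k : M^T = M -> (k <= n)%N ->
  exists2 s, size s = k & orthonormal_eigenseq M s.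
Proof.
move=> Msym; elim: k => [|k IHk] kn; first by exists [::].
have [s sk [us os es]] := IHk (ltnW kn).
pose B := \matrix_(i < k, j < n) s`_i j 0.
pose V := kermx B^T.
have VP (v : 'rV[R]_n) : (v <= V)%MS <-> {in s, forall x, dot x v^T = 0}.
  split=> [/sub_kermxP vB x /(nthP 0)[l]|sv].
    rewrite sk => lk <-; have /rowP/(_ (Ordinal lk)) := vB; rewrite !mxE => <-.
    by apply: eq_bigr => j _; rewrite !mxE mulrC.
  apply/sub_kermxP/rowP => i; rewrite !mxE.
  have si : s`_i \in s by rewrite mem_nth ?sk.
  by rewrite -[RHS](sv _ si); apply: eq_bigr => j _; rewrite !mxE mulrC.
have V0 : V != 0.
  have [|x x0 sx] := kernel_vector_seq (s := s); first by rewrite sk.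
  apply/rowV0Pn; exists x^T; last by rewrite trmx_eq0.
  by apply/VP => y ys; rewrite trmxK sx.
have VM : stablemx V M.
  apply/rV_subP => v /submxP[w ->]; rewrite mulmxA; apply/VP => x xs.
  have [a xa] := es x xs.
  rewrite trmx_mul Msym dot_sym_mx // xa dotZl.
  by have /VP -> // := submxMl w V; rewrite mulr0.
have [v v0 [vV [a va]]] := stable_eigenvector Msym VM V0.
have vs : {in s, forall x, dot x v^T = 0} by apply/VP.
have v0' : v^T != 0 by rewrite trmx_eq0.
have vv := dot_gt0 v0'.
pose x := (Num.sqrt (dot v^T v^T))^-1 *: v^T.
have xx : dot x x = 1.
  by rewrite /x dotZl dotZr mulrA -invfM -expr2 sqr_sqrtr ?ltW // mulVf ?gt_eqF.
have xs : {in s, forall y, dot y x = 0}.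
  by move=> y ys; rewrite /x dotZr (vs _ ys) mulr0.
have xNs : x \notin s.
  by apply/negP => /xs /eqP; rewrite xx oner_eq0.
exists (x :: s); first by rewrite /= sk.
split=> [|y z|y]; rewrite ?inE.
- by rewrite /= xNs.
- case/predU1P => [->|ys] /predU1P[->|zs].
  + by rewrite xx eqxx.
  + by rewrite dotC xs //; case: eqVneq xNs => // ->; rewrite zs.
  + by rewrite xs //; case: eqVneq xNs => // <-; rewrite ys.
  + exact: os.
- case/predU1P => [->|/es //]; exists a.
  have Mv : M *m v^T = a *: v^T by rewrite -linearZ /= -va trmx_mul Msym.
  by rewrite /x -scalemxAr Mv !scalerA mulrC.
Qed.

Lemma orthonormal_basis_unit (u : nat -> 'cV[R]_n) :
  (forall k l, (k < n)%N -> (l < n)%N -> dot (u k) (u l) = (k == l)%:R) ->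
  let P := \matrix_(i < n, j < n) u j i 0 in P *m P^T = 1%:M.
Proof.
move=> uo P; apply: mulmx1C.
apply/matrixP => i j; rewrite !mxE -[RHS](uo _ _ (ltn_ord i) (ltn_ord j)).
by apply: eq_bigr => k _; rewrite !mxE.
Qed.

Lemma eigenbasis_char_poly M (u : nat -> 'cV[R]_n) (d : nat -> R) :
  (forall k l, (k < n)%N -> (l < n)%N -> dot (u k) (u l) = (k == l)%:R) ->
  (forall k, (k < n)%N -> M *m u k = d k *: u k) ->
  char_poly M = \prod_(x <- mkseq d n) ('X - x%:P).
Proof.
move=> uo ud; pose P := \matrix_(i < n, j < n) u j i 0.
have PV : P *m P^T = 1%:M := orthonormal_basis_unit uo.
pose D := diag_mx (\row_(i < n) d i).
have MP : M *m P = P *m D.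
  apply/matrixP => i j; rewrite mul_mx_diag !mxE.
  have /colP/(_ i) := ud j (ltn_ord j); rewrite !mxE mulrC => <-.
  by apply: eq_bigr => k _; rewrite !mxE.
have -> : char_poly M = char_poly D.
  rewrite /char_poly.
  have -> : char_poly_mx M =
      map_mx polyC P *m char_poly_mx D *m map_mx polyC P^T.
    rewrite /char_poly_mx mulmxBr mulmxBl -!map_mxM.
    rewrite -MP -(mulmxA M) PV mulmx1.
    by rewrite scalar_mxC -mulmxA -map_mxM PV map_mx1 mulmx1.
  by rewrite !det_mulmx mulrAC -det_mulmx -map_mxM PV map_mx1 det1 mul1r.
rewrite char_poly_trig ?diag_mx_is_trig // big_map.
rewrite -[in iota 0 n](subn0 n) big_mkord.
by apply: eq_bigr => i _; rewrite !mxE eqxx.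
Qed.

(** Sorting an orthonormal family of n eigenvectors by their Rayleigh quotients
    turns the quotients into a sorted factorisation of the characteristic
    polynomial, which identifies them with the eigenvalue list. *)
Lemma spectral_theorem M : M^T = M ->
  (exists u, orthonormal_eigenbasis M u) /\
  (forall k l, (k <= l < n)%N -> lambda k M <= lambda l M).
Proof.
move=> Msym; have [t tn [ut ot et]] := orthonormal_eigenseq_ex Msym (leqnn n).
pose ray x := dot x (M *m x).
pose s := sort (fun x y => ray x <= ray y) t.
have sn : size s = n by rewrite size_sort.
have us : uniq s by rewrite sort_uniq.
have st k : (k < n)%N -> s`_k \in t.
  by move=> kn; rewrite -(mem_sort (fun x y => ray x <= ray y)) mem_nth ?sn.
have uo k l : (k < n)%N -> (l < n)%N -> dot s`_k s`_l = (k == l)%:R.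
  by move=> kn ln; rewrite ot ?st // nth_uniq ?sn.
have ud k : (k < n)%N -> M *m s`_k = ray s`_k *: s`_k.
  move=> kn; have [a sa] := et _ (st k kn).
  by rewrite /ray sa dotZr uo // eqxx mulr1.
have sorted_d : sorted <=%R (mkseq (fun k => ray s`_k) n).
  have -> : mkseq (fun k => ray s`_k) n = map ray s.
    by rewrite -[s in RHS](mkseq_nth 0) sn -map_comp.
  by rewrite sorted_map; apply: sort_sorted => x y; apply: le_total.
have eM : eigenvalues M = mkseq (fun k => ray s`_k) n.
  by apply: eigenvaluesE => //; apply: eigenbasis_char_poly uo ud.
split=> [|k l /andP[kl ln]].
  exists (nth 0 s); split=> // k kn; rewrite ud //.
  by rewrite /lambda eM nth_mkseq.
rewrite /lambda eM (sorted_leq_nth le_trans lexx) ?inE ?size_mkseq //.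
exact: leq_ltn_trans ln.
Qed.

Lemma symmetric_eigenbasis M : M^T = M -> exists u, orthonormal_eigenbasis M u.
Proof. by case/spectral_theorem. Qed.

Lemma lambda_nondecreasing M k l :
  M^T = M -> (k <= l < n)%N -> lambda k M <= lambda l M.
Proof. by case/spectral_theorem => _; apply. Qed.

End Spectral.

(** * Rayleigh quotients and interlacing *)

Section Variational.
Variables (R : realType) (n : nat).
Implicit Types (x y b : 'cV[R]_n) (M : 'M[R]_n) (u : nat -> 'cV[R]_n).

Lemma parseval M u x y : orthonormal_eigenbasis M u ->
  dot x y = \sum_(0 <= k < n) dot (u k) x * dot (u k) y.
Proof.
case=> _ uo; pose P := \matrix_(i < n, j < n) u j i 0.
have PV : P *m P^T = 1%:M := orthonormal_basis_unit uo.
have Pdot z (k : 'I_n) : (P^T *m z) k 0 = dot (u k) z.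
  by rewrite mxE; apply: eq_bigr => i _; rewrite !mxE.
have -> : dot x y = ((P^T *m x)^T *m (P^T *m y)) 0 0.
  by rewrite dotE trmx_mul trmxK -mulmxA (mulmxA P) PV mul1mx.
by rewrite mxE big_mkord; apply: eq_bigr => k _; rewrite mxE !Pdot.
Qed.

Lemma eigenbasis_form M u x : M^T = M -> orthonormal_eigenbasis M u ->
  dot x (M *m x) = \sum_(0 <= k < n) lambda k M * dot (u k) x ^+ 2.
Proof.
move=> Msym Mu; rewrite (parseval _ _ Mu); apply: eq_big_nat => k /andP[_ kn].
by rewrite dot_sym_mx // Mu.1 // dotZl mulrCA expr2.
Qed.

Lemma rayleigh_le M u x k : M^T = M -> orthonormal_eigenbasis M u ->
  (k < n)%N -> (forall j, (k < j < n)%N -> dot (u j) x = 0) ->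
  dot x (M *m x) <= lambda k M * dot x x.
Proof.
move=> Msym Mu kn ux; rewrite (eigenbasis_form _ Msym Mu) (parseval _ _ Mu).
rewrite mulr_sumr; apply: ler_sum_nat => j /andP[_ jn].
have [jk|kj] := leqP j k; last by rewrite ux ?kj // expr2 !mulr0.
rewrite -expr2 ler_wpM2r ?sqr_ge0 //.
by rewrite lambda_nondecreasing ?jk.
Qed.

Lemma rayleigh_ge M u x k : M^T = M -> orthonormal_eigenbasis M u ->
  (forall j, (j < k)%N -> dot (u j) x = 0) ->
  lambda k M * dot x x <= dot x (M *m x).
Proof.
move=> Msym Mu ux; rewrite (eigenbasis_form _ Msym Mu) (parseval _ _ Mu).
rewrite mulr_sumr; apply: ler_sum_nat => j /andP[_ jn].
have [kj|jk] := leqP k j; last by rewrite ux // expr2 !mulr0.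
rewrite -expr2 ler_wpM2r ?sqr_ge0 //.
by rewrite lambda_nondecreasing ?kj.
Qed.

(** Max-min half of the Courant-Fischer principle: the at most k constraints in
    s, together with orthogonality to the eigenvectors of index above k, are
    fewer than n, so some nonzero x satisfies them all; the Rayleigh quotient of
    that x lies between m and lambda k M. *)
Lemma lambda_ge M k m (s : seq 'cV[R]_n) : M^T = M -> (size s <= k < n)%N ->
  (forall x, {in s, forall y, dot y x = 0} -> m * dot x x <= dot x (M *m x)) ->
  m <= lambda k M.
Proof.
move=> Msym /andP[sk kn] sM; have [u Mu] := symmetric_eigenbasis Msym.
have [|x x0 xs] :=
    kernel_vector_seq (s := s ++ [seq u j | j <- index_iota k.+1 n]).
  rewrite size_cat size_map size_iota.
  by rewrite -[leqRHS](subnKC kn) -addSn leq_add2r.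
rewrite -(ler_pM2r (dot_gt0 x0)) (le_trans (sM _ _)) //.
  by move=> y ys; rewrite xs // mem_cat ys.
apply: (rayleigh_le Msym Mu) => // j jkn; apply: xs.
by rewrite mem_cat orbC map_f // mem_index_iota.
Qed.

Lemma rank_one_form M b x w :
  dot x ((M + w *: (b *m b^T)) *m x) = dot x (M *m x) + w * dot b x ^+ 2.
Proof.
rewrite mulmxDl dotDr -scalemxAl dotZr; congr (_ + _ * _).
have -> : b *m b^T *m x = dot b x *: b.
  rewrite -mulmxA [b^T *m x]mx11_scalar -dotE.
  by rewrite mul_mx_scalar.
by rewrite dotZr dotC expr2.
Qed.

Lemma rank_one_sym M b w :
  M^T = M -> (M + w *: (b *m b^T))^T = M + w *: (b *m b^T).
Proof. by move=> Msym; rewrite linearD linearZ /= trmx_mul trmxK Msym. Qed.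

(** Orthogonality to b, where the two forms agree, and to the first k
    eigenvectors of the perturbed matrix is a set of k.+1 constraints under
    which the form of M is at least the k-th perturbed eigenvalue. *)
Lemma rank_one_interlacing M b w k : M^T = M -> (k.+1 < n)%N ->
  lambda k (M + w *: (b *m b^T)) <= lambda k.+1 M.
Proof.
move=> Msym kn; have Nsym := rank_one_sym b w Msym.
have [v Nv] := symmetric_eigenbasis Nsym.
apply: (lambda_ge (s := b :: [seq v j | j <- iota 0 k])) => //.
  by rewrite /= size_map size_iota leqnn.
move=> x xs.
have -> : dot x (M *m x) = dot x ((M + w *: (b *m b^T)) *m x).
  by rewrite rank_one_form xs ?mem_head // expr0n mulr0 addr0.
apply: (rayleigh_ge Nsym Nv) => j jk.
by apply: xs; rewrite inE orbC map_f // mem_iota.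
Qed.

End Variational.

(** * A weighted Cauchy-Schwarz inequality *)

Section WeightedCauchySchwarz.
Variable R : realFieldType.

(** The cross term is controlled by the arithmetic-geometric mean inequality
    for x1 * y2 and x2 * y1. Bounding each square by a product, rather than
    dividing by a weight, covers a weight that vanishes along with its term. *)
Lemma sqr_add_le (a b x1 x2 y1 y2 : R) :
  0 <= x1 -> 0 <= y1 -> 0 <= x2 -> 0 <= y2 ->
  a ^+ 2 <= x1 * y1 -> b ^+ 2 <= x2 * y2 ->
  (a + b) ^+ 2 <= (x1 + x2) * (y1 + y2).
Proof.
move=> x1p y1p x2p y2p ax bx.
have ab : (2 * (a * b)) ^+ 2 <= (x1 * y2 + x2 * y1) ^+ 2.
  have : (a * b) ^+ 2 <= (x1 * y1) * (x2 * y2).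
    by rewrite exprMn ler_pM ?sqr_ge0.
  have := sqr_ge0 (x1 * y2 - x2 * y1); nra.
have {}ab : 2 * (a * b) <= x1 * y2 + x2 * y1.
  have : 0 <= x1 * y2 + x2 * y1 by rewrite addr_ge0 ?mulr_ge0.
  by rewrite leNgt => v0; apply/negP => vu; nra.
nra.
Qed.

Lemma sqr_sum_le (I : eqType) (r : seq I) (a x y : I -> R) :
  {in r, forall i, [/\ 0 <= x i, 0 <= y i & a i ^+ 2 <= x i * y i]} ->
  (\sum_(i <- r) a i) ^+ 2 <= (\sum_(i <- r) x i) * (\sum_(i <- r) y i).
Proof.
elim: r => [_|i r IHr axy]; first by rewrite !big_nil expr0n mulr0.
have [xi yi ai] := axy i (mem_head _ _).
have axy' : {in r, forall i, [/\ 0 <= x i, 0 <= y i & a i ^+ 2 <= x i * y i]}.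
  by move=> j jr; apply: axy; rewrite inE jr orbT.
rewrite !big_cons sqr_add_le ?IHr //.
  by rewrite big_seq sumr_ge0 // => j /axy'[].
by rewrite big_seq sumr_ge0 // => j /axy'[].
Qed.

End WeightedCauchySchwarz.

(** * Laplacians and the low-gap perturbation bound *)

Section Gap.
Variables (R : realType) (n : nat).
Implicit Types (x b : 'cV[R]_n) (M A : 'M[R]_n) (u : nat -> 'cV[R]_n).

Lemma laplacian_sym A : weighted_graph A -> (laplacian A)^T = laplacian A.
Proof.
case=> _ Asym; rewrite /laplacian linearB /= tr_diag_mx.
by congr (_ - _); apply/matrixP => i j; rewrite mxE Asym.
Qed.

Lemma laplacian_const A c : laplacian A *m const_mx c = 0 :> 'cV[R]_n.
Proof.
apply/colP => i; rewrite mulmxBl mul_diag_mx !mxE mulr_suml.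
by apply/eqP; rewrite subr_eq0; apply/eqP; apply: eq_bigr => j _; rewrite mxE.
Qed.

Lemma laplacian_lambda0 A u : (0 < n)%N -> orthonormal_eigenbasis (laplacian A) u ->
  u 0%N = const_mx (Num.sqrt n%:R)^-1 -> lambda 0 (laplacian A) = 0.
Proof.
move=> n0 [/(_ _ n0) + _] u0; rewrite u0 laplacian_const => /colP/(_ (Ordinal n0)).
rewrite !mxE => /esym/eqP; rewrite mulf_eq0 invr_eq0 sqrtr_eq0 leNgt ltr0n n0.
by rewrite orbF => /eqP.
Qed.

Lemma dot_edge_vec (p q : 'I_n) x : dot x (edge_vec R p q) = x p 0 - x q 0.
Proof.
rewrite dotE mulmxBr !mxE; congr (_ - _).
  rewrite (bigD1 p) //= !mxE !eqxx mulr1 big1 ?addr0 // => i /negPf ip.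
  by rewrite !mxE ip mulr0.
rewrite (bigD1 q) //= !mxE !eqxx mulr1 big1 ?addr0 // => i /negPf iq.
by rewrite !mxE iq mulr0.
Qed.

(** The loss gamma * c_1^2 along u 1 is repaid by w * <b, x>^2 and the higher
    modes, by Cauchy-Schwarz applied to beta_1 c_1 solved from the expansion of
    <b, x>. *)
Lemma perturbed_form_ge M u b x (w rho theta eps : R) :
  let l := fun k => lambda k M in
  let be := fun k => dot (u k) b in
  let gamma := l 2 - l 1 in
  M^T = M -> orthonormal_eigenbasis M u -> (3 < n)%N ->
  0 < w -> 0 < rho < 1 -> theta < 1 -> 0 <= eps ->
  0 <= l 1 -> l 1 < l 2 -> l 2 <= rho * l 3 -> be 1 != 0 ->
  gamma * (w^-1 + (\sum_(3 <= k < n) be k ^+ 2 / l k) / (1 - rho))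
     <= theta * be 1 ^+ 2 ->
  be 2 ^+ 2 <= eps * be 1 ^+ 2 ->
  dot (u 0) x = 0 ->
  (l 2 - gamma / (1 - theta) * eps) * dot x x
    <= dot x (M *m x) + w * dot b x ^+ 2.
Proof.
move=> l be gamma Msym Mu n3 w0 /andP[rho0 rho1] theta1 eps0 l1 l12 l23 be1.
move=> gap be2 ux0.
pose c k := dot (u k) x.
have gamma0 : 0 < gamma by rewrite subr_gt0.
have rhoB : 0 < 1 - rho by rewrite subr_gt0.
have thetaB : 0 < 1 - theta by rewrite subr_gt0.
have l3 : 0 < l 3.
  by rewrite -(pmulr_rgt0 _ rho0) (lt_le_trans _ l23) // (le_lt_trans l1).
have l3k k : (3 <= k < n)%N -> l 3 <= l k by apply: lambda_nondecreasing.
have l_gt0 k : (3 <= k < n)%N -> 0 < l k by move/l3k; apply: lt_le_trans.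
pose delta := gamma / (1 - theta) * eps.
have delta0 : 0 <= delta by rewrite mulr_ge0 // ltW // divr_gt0.
have split3 (f : nat -> R) : f 0%N = 0 ->
    \sum_(0 <= k < n) f k = f 1%N + f 2 + \sum_(3 <= k < n) f k.
  move=> f0; rewrite big_ltn ?(ltn_trans _ n3) // f0 add0r.
  by rewrite big_ltn ?(ltn_trans _ n3) // big_ltn ?(ltn_trans _ n3) // addrA.
have bx : dot b x = be 1%N * c 1%N + be 2 * c 2 + \sum_(3 <= k < n) be k * c k.
  by rewrite (parseval _ _ Mu) split3 // ux0 mulr0.
have xx : dot x x = c 1%N ^+ 2 + c 2 ^+ 2 + \sum_(3 <= k < n) c k ^+ 2.
  by rewrite (parseval _ _ Mu) split3 // ux0 mulr0.
have xMx : dot x (M *m x) =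
    l 1%N * c 1%N ^+ 2 + l 2 * c 2 ^+ 2 + \sum_(3 <= k < n) l k * c k ^+ 2.
  by rewrite (eigenbasis_form _ Msym Mu) split3 // ux0 expr0n mulr0.
rewrite -/delta.
pose T := \sum_(3 <= k < n) be k ^+ 2 / l k.
pose Y := \sum_(3 <= k < n) (1 - rho) * l k * c k ^+ 2.
have T0 : 0 <= T.
  rewrite /T big_nat sumr_ge0 // => k kn.
  by rewrite divr_ge0 ?sqr_ge0 // ltW ?l_gt0.
have Y0 : 0 <= Y.
  rewrite /Y big_nat sumr_ge0 // => k kn.
  by apply: mulr_ge0; [apply/ltW/mulr_gt0; last exact: l_gt0 | exact: sqr_ge0].
have tail_le : (\sum_(3 <= k < n) be k * c k) ^+ 2 <= T / (1 - rho) * Y.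
  rewrite /T mulr_suml; apply: sqr_sum_le => k; rewrite mem_index_iota => kn.
  have lk := l_gt0 _ kn.
  split.
  - by rewrite !divr_ge0 ?sqr_ge0 ?ltW.
  - by apply: mulr_ge0; [exact/ltW/mulr_gt0 | exact: sqr_ge0].
  - rewrite le_eqVlt; apply/orP; left; apply/eqP; field.
    by rewrite !gt_eqF.
(* Here lambda_2 <= rho lambda_3 <= rho lambda_k. *)
have rest_le : Y + (l 2 - delta) * (\sum_(3 <= k < n) c k ^+ 2)
     <= \sum_(3 <= k < n) l k * c k ^+ 2.
  rewrite /Y mulr_sumr -big_split /=; apply: ler_sum_nat => k kn.
  rewrite -mulrDl ler_wpM2r ?sqr_ge0 //.
  have := ler_wpM2l (ltW rho0) (l3k k kn); lra.
pose F := w^-1 + be 2 ^+ 2 / delta + T / (1 - rho).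
pose Q := w * dot b x ^+ 2 + delta * c 2 ^+ 2 + Y.
have w_le : dot b x ^+ 2 <= w^-1 * (w * dot b x ^+ 2).
  by rewrite mulKf ?gt_eqF.
(* If delta = 0 then eps = 0, hence beta_2 = 0 and the quotient by delta = 0,
   whose value is 0, still fits. *)
have two_le : (- (be 2 * c 2)) ^+ 2 <= be 2 ^+ 2 / delta * (delta * c 2 ^+ 2).
  rewrite sqrrN exprMn; have [d0|d0] := eqVneq delta 0; last first.
    by rewrite mulrA divfK.
  have e0 : eps = 0.
    by move: d0 => /eqP; rewrite mulf_eq0 gt_eqF ?divr_gt0 //= => /eqP.
  move: be2; rewrite e0 mul0r => /(ler_wpM2r (sqr_ge0 (c 2))).
  by rewrite mul0r d0 mul0r mulr0.
have F_le : gamma * F <= be 1%N ^+ 2.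
  have : gamma * (be 2 ^+ 2 / delta) <= (1 - theta) * be 1%N ^+ 2.
    have [d0|d0] := eqVneq delta 0.
      by rewrite d0 invr0 !mulr0 mulr_ge0 ?sqr_ge0 ?ltW.
    have dp : 0 < delta by rewrite lt_neqAle eq_sym d0.
    rewrite mulrA ler_pdivrMr //.
    have -> : (1 - theta) * be 1%N ^+ 2 * delta = gamma * (eps * be 1%N ^+ 2).
      by rewrite /delta; field; rewrite gt_eqF.
    by rewrite ler_pM2l.
  move: gap; rewrite -/T /F; lra.
have wb0 : 0 <= w * dot b x ^+ 2 := mulr_ge0 (ltW w0) (sqr_ge0 _).
have dc0 : 0 <= delta * c 2 ^+ 2 := mulr_ge0 delta0 (sqr_ge0 _).
have wV0 : 0 <= w^-1 by rewrite invr_ge0 ltW.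
have bd0 : 0 <= be 2 ^+ 2 / delta by rewrite divr_ge0 ?sqr_ge0.
have Q0 : 0 <= Q by rewrite !addr_ge0.
have key : (be 1%N * c 1%N) ^+ 2 <= F * Q.
  have -> : be 1%N * c 1%N =
      dot b x + - (be 2 * c 2) + - \sum_(3 <= k < n) be k * c k.
    by rewrite bx; ring.
  apply: sqr_add_le => //; rewrite ?sqrrN //.
  - exact: addr_ge0.
  - exact: addr_ge0.
  - by rewrite divr_ge0 // ltW.
  - by apply: sqr_add_le.
have c1_le : gamma * c 1%N ^+ 2 <= Q.
  have b1 : 0 < be 1%N ^+ 2 by rewrite exprn_even_gt0.
  rewrite -(ler_pM2l b1).
  apply: le_trans (ler_wpM2r Q0 F_le).
  have := ler_wpM2l (ltW gamma0) key; lra.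
have := mulr_ge0 delta0 (sqr_ge0 (c 1%N)).
move: c1_le; rewrite xMx xx /Q /gamma; lra.
Qed.

End Gap.

Theorem theorem4p5 (R : realType) (L0 w0 theta0 : R)
  (L0_gt0 : 0 < L0) (w0_gt0 : 0 < w0) (theta0_01 : 0 < theta0 < 1) :
  exists2 C : R, 0 < C &
  forall (n : nat) (A : 'M[R]_n) (u : nat -> 'cV[R]_n) (p q : 'I_n)
         (w rho0 a0 A0 eps : R),
  let L := laplacian A in
  let gamma := lambda 2 L - lambda 1 L in
  (4 <= n)%N ->
  weighted_graph A ->
  connected_graph A ->
  orthonormal_eigenbasis L u ->
  u 0%N = const_mx (Num.sqrt n%:R)^-1 ->
  p != q ->
  0 <= w ->
  lambda 1 L < lambda 2 L ->
  0 < rho0 < 1 ->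
  0 < a0 ->
  0 < A0 ->
  lambda 2 L <= rho0 * lambda 3 L ->
  a0 / n%:R <= beta u p q 1 ^+ 2 ->
  T3plus L u p q <= A0 * n%:R ->
  lambda 2 L <= L0 / n%:R ^+ 2 ->
  w0 <= w ->
  gamma * (w^-1 + T3plus L u p q / (1 - rho0)) <= theta0 * beta u p q 1 ^+ 2 ->
  0 <= eps ->
  beta u p q 2 ^+ 2 <= eps * beta u p q 1 ^+ 2 ->
  0 <= gamma - conn_gain L p q w <= gamma / (1 - theta0) * eps /\
  0 <= gamma - conn_gain L p q w <= C * (w / n%:R) * eps.
Proof.
have /andP[_ theta1] := theta0_01.
have thetaB : 0 < 1 - theta0 by rewrite subr_gt0.
exists (L0 / (w0 * (1 - theta0))); first by rewrite divr_gt0 ?mulr_gt0.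
move=> n A u p q w rho0 a0 A0 eps L gamma n4 wA _ Lu u0 _ _ l12 rho01 a0_gt0 _ l23.
move=> beta1 _ l2 w0w gap eps0 beta2.
have w_gt0 : 0 < w := lt_le_trans w0_gt0 w0w.
have n_gt0 : (0 < n)%N := ltn_trans (isT : (0 < 3)%N) n4.
have nR : 0 < n%:R :> R by rewrite ltr0n.
have Lsym := laplacian_sym wA.
have lambda0 : lambda 0 L = 0 := laplacian_lambda0 n_gt0 Lu u0.
have l1 : 0 <= lambda 1 L.
  by rewrite -lambda0 lambda_nondecreasing // (ltn_trans _ n4).
pose b := edge_vec R p q.
have beta_dot k : beta u p q k = dot (u k) b by rewrite dot_edge_vec.
have beta1_neq0 : dot (u 1%N) b != 0.
  rewrite -beta_dot; apply: contraTneq beta1 => ->.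
  by rewrite expr0n -ltNge divr_gt0.
have gainE : gamma - conn_gain L p q w = lambda 2 L - lambda 1 (edge_update L p q w).
  by rewrite /gamma /conn_gain; ring.
have lower : 0 <= gamma - conn_gain L p q w.
  rewrite gainE subr_ge0; apply: rank_one_interlacing => //.
  exact: ltn_trans n4.
have upper : gamma - conn_gain L p q w <= gamma / (1 - theta0) * eps.
  rewrite gainE lerBlDr -lerBlDl.
  apply: (lambda_ge (s := [:: u 0%N])); first exact: rank_one_sym.
    by rewrite (ltn_trans _ n4).
  move=> x xu; rewrite rank_one_form.
  apply: (perturbed_form_ge (rho := rho0) (theta := theta0) Lsym Lu) => //.
  - rewrite -beta_dot; apply: le_trans gap; rewrite le_eqVlt; apply/orP; left.
    apply/eqP; congr (_ * (_ + _ / _)); apply: eq_bigr => k _.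
    by rewrite beta_dot.
  - by rewrite -!beta_dot.
  - by rewrite xu ?mem_head.
split; first by rewrite lower.
rewrite lower (le_trans upper) // ler_wpM2r //.
have gamma_le : gamma <= L0 / n%:R.
  have : gamma <= L0 / n%:R ^+ 2 by rewrite /gamma; lra.
  move=> /le_trans; apply.
  by rewrite ler_pM2l // lef_pV2 ?posrE ?exprn_gt0 // ler_eXnr ?ler1n.
rewrite ler_pdivrMr //.
have -> : L0 / (w0 * (1 - theta0)) * (w / n%:R) * (1 - theta0) =
    L0 / n%:R * (w / w0).
  by field; rewrite !gt_eqF.
apply: le_trans gamma_le _.
by rewrite ler_peMr ?(ltW (divr_gt0 L0_gt0 nR)) // ler_pdivlMr // mul1r.
Qed.
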